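(* Let $G$ be a connected $p$-partite graph of order $n$, with partite sets of cardinalities $n_1,n_2,\dots,n_p$. If $\delta(G)\geq n_i$ for some $i$, then $\chi_d^t(G)\leq n-n'+1$, where $n'=\max\{n_i : \delta(G)\geq n_i\}$.
   Context: All graphs are finite, simple and undirected; $\delta(G)$ is the minimum degree. A $p$-partite graph is one whose vertex set is partitioned into $p$ independent sets (the partite sets). A total dominator coloring of a graph $G$ is a proper vertex coloring of $G$ in which each vertex of $G$ is adjacent to every vertex of some color class (a color class is the set of all vertices receiving a given color). The total dominator chromatic number $\chi_d^t(G)$ is the minimum number of color classes in a total dominator coloring of $G$. *)

(* Defs.v *)
From mathcomp Require Import all_boot.

Set Implicit Arguments.
Unset Strict Implicit.
Unset Printing Implicit Defensive.

Record sgraph := SGraph {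
  vertex :> finType;
  adj : rel vertex;
  adj_sym : symmetric adj;
  adj_irrefl : irreflexive adj
}.

Definition neighbors (G : sgraph) (v : G) : {set G} := [set u | adj v u].

(* The default #|G| exceeds every degree, so it is irrelevant as soon as G has
   a vertex. *)
Definition min_degree (G : sgraph) : nat :=
  \big[minn/#|G|]_(v : G) #|neighbors v|.

Definition connected_graph (G : sgraph) : Prop :=
  0 < #|G| /\ forall u v : G, connect (@adj G) u v.

Definition independent (G : sgraph) (A : {set G}) : Prop :=
  {in A &, forall u v, ~~ adj u v}.

(* [partition] makes the sets nonempty and pairwise disjoint as members of a
   set of sets; injectivity makes them pairwise distinct as an indexed family. *)
Definition partite_sets (G : sgraph) (p : nat) (V : 'I_p -> {set G}) : Prop :=
  [/\ injective V,
      partition [set V i | i : 'I_p] [set: G] &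
      forall i, independent (V i)].

Definition color_class (G : sgraph) (C : finType) (c : G -> C) (k : C) :
  {set G} := [set u | c u == k].

Definition proper_coloring (G : sgraph) (C : finType) (c : G -> C) : bool :=
  [forall u, forall v, adj u v ==> (c u != c v)].

(* Only colors that are actually used count: an unused color would be
   dominated vacuously by every vertex. *)
Definition total_dominator_coloring (G : sgraph) (C : finType) (c : G -> C) :
  bool :=
  proper_coloring c &&
  [forall v : G, exists k : C,
     (k \in codom c) && (color_class c k \subset neighbors v)].

Definition has_tdc (G : sgraph) (k : nat) : bool :=
  [exists c : {ffun G -> 'I_k},
     total_dominator_coloring c && (#|codom c| == k)].

(* The least k such that [has_tdc G k]. A coloring has at most #|G| color
   classes, so the search range is exhaustive; the value is #|G|.+1 exactly
   when G has no total dominator coloring, i.e. when it has an isolated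
   vertex. *)
Definition total_dominator_chromatic_number (G : sgraph) : nat :=
  find (has_tdc G) (iota 0 #|G|.+1).

(* Main.v *)
Require Import Defs.
From mathcomp Require Import all_boot.

(** Collapse a largest admissible partite set [A] to a single color and give
    every other vertex a color of its own. A vertex with a neighbor outside [A]
    dominates the singleton class of that neighbor; otherwise its neighborhood
    lies in [A] and has at least [#|A|] elements, hence equals the class [A]. *)

Lemma tdc_number_le (G : sgraph) (C : finType) (c : G -> C) :
  total_dominator_coloring c ->
  total_dominator_chromatic_number G <= #|codom c|.
Proof.
move=> /andP[/forallP properc /forallP domc].
suff hasc : has_tdc G #|codom c|.
  (* [find] stops at the first success, and [#|codom c| <= #|G|] keeps this index within the [iota]
     range. *)
  rewrite leqNgt; apply/negP => /(before_find 0).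
  by rewrite nth_iota ?ltnS ?leq_image_card ?add0n ?hasc.
pose r := [ffun u : G => enum_rank_in (codom_f c u) (c u)].
have rK u : enum_val (r u) = c u by rewrite ffunE enum_rankK_in ?codom_f.
have rE u v : (r u == r v) = (c u == c v).
  by rewrite -(inj_eq enum_val_inj) !rK.
apply/existsP; exists r; rewrite /total_dominator_coloring -andbA.
apply/and3P; split.
- apply/forallP => u; apply/forallP => v.
  by rewrite rE; exact: (forallP (properc u) v).
- apply/forallP => v; have /existsP[k /andP[/codomP[w ->] sub]] := domc v.
  apply/existsP; exists (r w); rewrite codom_f /=.
  by apply: subset_trans sub; apply/subsetP => u; rewrite !inE rE.
- rewrite -[X in _ == X]card_ord; apply/eqP/eq_card => j.
  have /codomP[u ju] := enum_valP j.
  by rewrite (_ : j = r u) ?codom_f //; apply: enum_val_inj; rewrite rK.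
Qed.

Lemma min_degree_le (G : sgraph) (v : G) : min_degree G <= #|neighbors v|.
Proof.
rewrite /min_degree; elim: index_enum (mem_index_enum v) => // u s IHs.
rewrite inE big_cons geq_min => /predU1P[<-|/IHs ->]; first by rewrite leqnn.
by rewrite orbT.
Qed.

Lemma tdc_number_le_independent (G : sgraph) (A : {set G}) :
  independent A -> A != set0 -> #|A| <= min_degree G ->
  total_dominator_chromatic_number G <= #|G| - #|A| + 1.
Proof.
move=> indA /set0Pn[a aA] leA.
(* Vertices serve as colors, with [a] representing [A]; hence the used colors lie in [a |: ~: A]. *)
pose c (u : G) := if u \in A then a else u.
have codomc : #|codom c| <= #|G| - #|A| + 1.
  have <- : #|~: A| = #|G| - #|A| by rewrite -(cardsC A) addKn.
  apply: (@leq_trans #|a |: ~: A|); last by rewrite cardsU1 addnC leq_add2l leq_b1.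
  apply/subset_leq_card/subsetP => _ /codomP[u ->].
  by rewrite /c; case: ifP => uA; rewrite !inE ?eqxx ?uA ?orbT.
apply: leq_trans codomc; apply: tdc_number_le; apply/andP; split.
  apply/forallP => u; apply/forallP => v; apply/implyP => uv.
  rewrite /c; case: ifP => uA; case: ifP => vA.
  - by have := indA u v uA vA; rewrite uv.
  - by apply: contraFneq vA => <-.
  - by apply: contraFneq uA => ->.
  - by apply: contraTneq uv => ->; rewrite adj_irrefl.
apply/forallP => v; apply/existsP.
have degv : #|A| <= #|neighbors v| by exact: leq_trans leA (min_degree_le _ v).
have [sNA|/subsetPn[w vw wA]] := boolP (neighbors v \subset A).
  have NA : neighbors v = A by apply/eqP; rewrite eqEcard sNA.
  exists (c a); rewrite codom_f NA; apply/subsetP => u.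
  by rewrite inE /c aA; case: ifP => // uA /eqP ua; rewrite -uA ua aA.
(* The class of [w] is a singleton: vertices of [A] have color [a], which differs from [w] because
   [w] is outside [A]. *)
exists (c w); rewrite codom_f; apply/subsetP => u.
rewrite inE /c (negbTE wA); case: ifP => uA /eqP uw; last by rewrite uw.
by rewrite -uw aA in wA.
Qed.

Theorem theorem3p8 (G : sgraph) (p : nat) (V : 'I_p -> {set G}) :
  connected_graph G ->
  partite_sets V ->
  (exists i : 'I_p, #|V i| <= min_degree G) ->
  total_dominator_chromatic_number G <=
    #|G| - \max_(i < p | #|V i| <= min_degree G) #|V i| + 1.
Proof.
move=> _ [_ /and3P[_ _ V0] indV] [i0 Vi0].
(* The index [i0] makes the range of the maximum nonempty, so the maximum is attained at some
   admissible [i]. *)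
rewrite (bigmax_eq_arg i0) //; case: arg_maxnP => // i Vi _.
apply: tdc_number_le_independent => //.
by apply: contraNneq V0 => <-; apply: imset_f.
Qed.
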